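(* Let $(X,Y,\langle\cdot,\cdot\rangle)$ be a dual system. Let $K\subset X$ be convex, let $\emptyset\neq C\subset K$, and let $F:K\to Y$. Let $\beta$ be a linear Hausdorff topology on $\operatorname{lin}K$ such that $(K,\beta)$ is compact. Assume that, for every $a\in C$, the function $f_{a}:K\to\mathbb{R}$, $f_{a}(x):=\langle a-x,F(x)\rangle$, is $\beta$-upper semicontinuous; equivalently, whenever $\{x_i\}_i\subset K$ is a net with $x_i\overset{\beta}{\to}x_0$, one has $$\forall a\in C,\quad \limsup_{i}\langle a-x_i,F(x_i)\rangle\le\langle a-x_0,F(x_0)\rangle.$$ Then there exists $x\in K$ such that $$\forall u\in\operatorname{conv}C,\quad \langle u-x,F(x)\rangle\ge0.$$ In particular, the upper semicontinuity assumption holds, and hence such an $x$ exists, if $F:(K,\beta)\to(Y,\sigma(Y,C))$ is continuous and, for every net $\{x_i\}_i\subset K$ with $x_i\overset{\beta}{\to}x_0$, we have $\langle x_0,F(x_0)\rangle\le\liminf_i\langle x_i,F(x_i)\rangle$.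
   Context: A dual system $(X,Y,\langle\cdot,\cdot\rangle)$ consists of real vector spaces $X,Y$ and a bilinear form $\langle\cdot,\cdot\rangle:X\times Y\to\mathbb{R}$; no separation is assumed. $\operatorname{lin}K$ is the linear span of $K$ in $X$; a linear topology is a vector space topology (not necessarily locally convex); $K$ carries the trace of $\beta$. $\sigma(Y,C)$ is the weakest topology on $Y$ making all linear forms $y\mapsto\langle x,y\rangle$, $x\in C$, continuous. *)

(* Defs.v *)
From HB Require Import structures.
From mathcomp Require Export all_boot all_order all_algebra.
From mathcomp Require Export all_classical all_reals all_analysis.
Export Order.TTheory GRing.Theory Num.Theory.
Export numFieldNormedType.Exports.

Set Implicit Arguments.
Unset Strict Implicit.
Unset Printing Implicit Defensive.

Local Open Scope classical_set_scope.
Local Open Scope ring_scope.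

Section LinearHulls.
Context {R : realType} {X : lmodType R}.

Definition linset (K : set X) : set X :=
  [set x | exists n (c : 'I_n -> R) (v : 'I_n -> X),
     (forall i, K (v i)) /\ x = \sum_(i < n) c i *: v i].

Definition conv_hull (C : set X) : set X :=
  [set x | exists n (c : 'I_n -> R) (v : 'I_n -> X),
     [/\ forall i, C (v i), forall i, 0 <= c i, \sum_(i < n) c i = 1
       & x = \sum_(i < n) c i *: v i]].

Definition linpred (K : set X) : {pred X} := fun x => `[< linset K x >].

Lemma linpred_submod (K : set X) : submod_closed (linpred K).
Proof.
split.
  apply/asboolP; exists 0%N, (fun=> 0), (fun=> 0).
  by split=> [[]//|]; rewrite big_ord0.
move=> a x y /asboolP[n [c [v [Kv ->]]]] /asboolP[m [d [w [Kw ->]]]].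
apply/asboolP; exists (n + m)%N.
exists (fun i : 'I_(n + m) => match fintype.split i with inl j => a * c j | inr j => d j end).
exists (fun i : 'I_(n + m) => match fintype.split i with inl j => v j | inr j => w j end).
split=> [i|]; first by case: (fintype.split i).
rewrite big_split_ord scaler_sumr; congr (_ + _); apply: eq_bigr => i _.
  by rewrite (unsplitK (inl i)) scalerA.
by rewrite (unsplitK (inr i)).
Qed.

HB.instance Definition _ (K : set X) :=
  GRing.isSubmodClosed.Build R X (linpred K) (linpred_submod K).

(* The span of K as a vector space in its own right. *)
Record lin (K : set X) := Lin { lin_val : X ; lin_valP : lin_val \in linpred K }.

HB.instance Definition _ (K : set X) := [isSub for @lin_val K].
HB.instance Definition _ (K : set X) := [Choice of lin K by <:].
HB.instance Definition _ (K : set X) :=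
  [SubChoice_isSubLmodule of lin K by <:].

Lemma linset_sub (K : set X) : K `<=` linset K.
Proof.
move=> x Kx; exists 1%N, (fun=> 1), (fun=> x).
by rewrite big_ord1 scale1r.
Qed.

Definition to_lin (K : set X) (x : K) : lin K :=
  Lin (asboolT (linset_sub (set_valP x)) : val x \in linpred K).

End LinearHulls.

(* As for [sup_topology], an arbitrary topology on V is an element of the class
   [Topological V]; the vector space operations below are those of V. *)
Definition linear_topology {R : realType} {V : lmodType R}
    (tau : Topological V) : Prop :=
  let T : topologicalType := Topological.Pack tau in
  continuous ((fun z : V * V => z.1 + z.2) : T * T -> T) /\
  continuous ((fun z : R * V => z.1 *: z.2) : R^o * T -> T).

(* (K, beta): the points of K with the topology inherited from (lin K, beta). *)
Definition trace {R : realType} {X : lmodType R} {K : set X}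
    (beta : Topological (lin K)) : topologicalType :=
  initial_topology (@to_lin R X K : K -> Topological.Pack beta).

Definition sigma_topology {R : realType} {X Y : lmodType R}
    (br : X -> Y -> R) (C : set X) : topologicalType :=
  sup_topology (fun c : C =>
    Topological.class (initial_topology (br (val c) : Y -> R^o))).

Definition upper_semicontinuous {R : realType} {T : topologicalType}
    (f : T -> R) : Prop :=
  forall x a, f x < a -> \forall y \near x, f y < a.

Section Nets.
Context {I : Type} (le : I -> I -> Prop).

Definition directed : Prop :=
  [/\ inhabited I, (forall i, le i i),
      (forall i j k, le i j -> le j k -> le i k)
    & (forall i j, exists k, le i k /\ le j k)].

Definition net_tails : set_system I :=
  filter_from [set: I] (fun i => [set j | le i j]).

Definition net_limsup {R : realType} (u : I -> R) : \bar R :=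
  ereal_inf [set ereal_sup [set (u j)%:E | j in [set j | le i j]] | i in [set: I]].

Definition net_liminf {R : realType} (u : I -> R) : \bar R :=
  ereal_sup [set ereal_inf [set (u j)%:E | j in [set j | le i j]] | i in [set: I]].

End Nets.

(* Main.v *)
Require Import Defs.
From mathcomp Require Import zify lra.

(* Suppose that finitely many of the open sets U_i = {f_(a_i) < 0} cover K, and
   pull them back to the standard simplex along l |-> \sum_i l_i a_i.  Scarf's
   combinatorial form of Sperner's lemma, applied to a fine grid coloured by a
   Lebesgue number, yields l such that x = \sum_i l_i a_i lies in U_i for every i
   with l_i > 0.  This is absurd, since \sum_i l_i f_(a_i)(x) = <x - x, F x> = 0.
   So the closed sets {f_a >= 0}, a in C, have the finite intersection property;
   a common point solves the inequality on C, hence on conv C by linearity. *)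

Set Implicit Arguments.
Unset Strict Implicit.
Unset Printing Implicit Defensive.

(** * Scarf's theorem on dominant sets *)

Section DominantSets.
(* Restores the [finset] lemmas shadowed by [classical_sets]. *)
Import fintype finset.
Variables (I T : finType) (r : I -> T -> nat).
Hypothesis r_inj : forall i, injective (r i).
Implicit Types (s t : {set T}) (x y z : T).

(** Scarf's primitive sets: no point lies strictly above the minimum of [s] in all the orders at
    once. *)
Definition dominant s :=
  [forall y, exists i, [forall x in s, r i y <= r i x]].

Lemma dominantP s :
  reflect (forall y, exists i, {in s, forall x, r i y <= r i x}) (dominant s).
Proof.
apply: (iffP forallP) => H y; first
  by have /existsP[i /forall_inP] := H y; exists i.
by have [i Hi] := H y; apply/existsP; exists i; apply/forall_inP.
Qed.

Lemma dominantS s t : s \subset t -> dominant t -> dominant s.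
Proof.
move=> /subsetP st /dominantP tD; apply/dominantP => y.
by have [i iP] := tD y; exists i => x /st; apply: iP.
Qed.

(** * Lowest points and summits of a dominant set *)

Section Facets.
Variables (s : {set T}) (x0 : T).
Hypotheses (x0s : x0 \in s) (sD : dominant s).

Definition lowest i := [arg min_(x < x0 in s) r i x].

Lemma lowest_in i : lowest i \in s.
Proof. by rewrite /lowest; case: arg_minnP. Qed.

Lemma lowest_le i x : x \in s -> r i (lowest i) <= r i x.
Proof. by rewrite /lowest; case: arg_minnP => // y _ /[apply]. Qed.

(** Dominance at [x] itself provides an order in which [x] is the minimum of [s]. *)
Lemma dominant_lowest x : x \in s -> exists i, x = lowest i.
Proof.
move=> xs; have /dominantP/(_ x)[i iP] := sD; exists i.
apply: (@r_inj i); apply/eqP.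
by rewrite eqn_leq iP ?lowest_in ?lowest_le.
Qed.

Lemma lowest_imset : [set lowest i | i in I] = s.
Proof.
apply/setP => x; apply/imsetP/idP => [[i _ ->]|/dominant_lowest[i ->]].
  exact: lowest_in.
by exists i.
Qed.

Lemma dominant_leq : #|s| <= #|I|.
Proof. by rewrite -lowest_imset leq_imset_card. Qed.

(** Adding such a [y] to [s] can change the lowest point for the order [k] only. *)
Definition above k y := [forall l, (l != k) ==> (r l (lowest l) < r l y)].

Lemma aboveP k y :
  reflect (forall l, l != k -> r l (lowest l) < r l y) (above k y).
Proof. by apply: (iffP forallP) => H l; have /implyP := H l. Qed.

Lemma above_le k y : above k y -> {in s, forall x, r k y <= r k x}.
Proof.
move=> /aboveP ky; have /dominantP/(_ y)[l lP] := sD.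
have [<-//|/ky] := eqVneq l k.
by rewrite ltnNge lP ?lowest_in.
Qed.

Hypothesis above_ex : forall k, exists y, above k y.

Definition summit k := [arg max_(y > xchoose (above_ex k) | above k y) r k y].

Lemma summit_above k : above k (summit k).
Proof. by rewrite /summit; case: arg_maxnP => //; apply: xchooseP. Qed.

Lemma summit_ge k y : above k y -> r k y <= r k (summit k).
Proof.
by rewrite /summit; case: arg_maxnP => [|z _ H]; [exact: xchooseP|exact: H].
Qed.

Section Collision.
Variables (i j : I).
Hypotheses (ij : i != j) (lowij : lowest i = lowest j).

Lemma collision_imset : [set lowest l | l in [set~ i]] = s.
Proof.
apply/setP => x; apply/imsetP/idP => [[l _ ->]|/dominant_lowest[l ->]].
  exact: lowest_in.
have [->|li] := eqVneq l i; last by exists l; rewrite // !inE.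
by exists j; rewrite // !inE eq_sym.
Qed.

(** Even without the order [i], every point of [s] is lowest for some order, and there the summit
    lies strictly above it. *)
Lemma summit_notin : summit i \notin s.
Proof.
apply/negP => ys; move: (ys); rewrite -collision_imset => /imsetP[l].
rewrite !inE => li e; have /aboveP/(_ l li) := summit_above i.
by rewrite -e ltnn.
Qed.

(** Points satisfying [above i] are dominated in the order [i], by the choice of the summit. Any
    other point fails to pass the minimum of [s] in some order [l != i], where the summit lies above
    that minimum. *)
Lemma summit_dominant : dominant (summit i |: s).
Proof.
apply/dominantP => z; have [zi|] := boolP (above i z).
  exists i => x /setU1P[->|xs]; first exact: summit_ge.
  exact: above_le xs.
move=> /forallPn[l]; rewrite negb_imply -leqNgt => /andP[li zl].

exists l => x /setU1P[->|xs]; last exact: leq_trans zl (lowest_le _ xs).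
have /aboveP/(_ l li) := summit_above i; by move/ltnW; apply: leq_trans.
Qed.

End Collision.

End Facets.

(** * Completions of a facet to a dominant set *)

Section Cofacets.
Variables (s : {set T}) (x0 : T).
Hypotheses (x0s : x0 \in s) (sD : dominant s) (cardI : #|I| = #|s|.+1).
Hypothesis above_ex : forall k, exists y, above s x0 k y.

(* As [i] and [j] are the only indices sharing their lowest point of [s], the
   new point must take over the role of lowest point from one of them. *)
Lemma cofacet_summit i j y : i != j -> lowest s x0 i = lowest s x0 j ->
  y \notin s -> dominant (y |: s) ->
  y = summit above_ex i \/ y = summit above_ex j.
Proof.
move=> ij lowij ys tD; pose t := y |: s.
have st : s \subset t by apply: finset.subsetUr.
have x0t : x0 \in t by apply: (fintype.subsetP st).
pose low := lowest t x0.
(* [low] maps [I] onto [t], which has as many elements. *)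
have low_inj : injective low.
  have cardt : #|I| = #|t| by rewrite cardsU1 ys cardI.
  apply/injectiveP/card_uniqP; rewrite size_map -cardE cardt.
  apply: eq_card => x; rewrite -[in RHS](lowest_imset x0t tD).
  by apply/mapP/imsetP => -[l _ ->]; exists l; rewrite ?mem_enum.
have [k yk] : exists k, y = low k by apply: dominant_lowest; rewrite ?setU11.
have lowE l : l != k -> low l = lowest s x0 l.
  move=> lk; have ls : low l \in s.
    have := lowest_in x0t l; rewrite -/low => /setU1P[|//].
    by rewrite yk => /low_inj/eqP; rewrite (negPf lk).
  apply: (@r_inj l); apply/eqP; rewrite eqn_leq lowest_le ?lowest_le //.
  by apply: (fintype.subsetP st); apply: lowest_in.
have ky : above s x0 k y.
  apply/aboveP => l lk; rewrite -lowE // ltn_neqAle lowest_le ?setU11 // andbT.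
  by apply: contraNN lk => /eqP/r_inj; rewrite yk => /low_inj ->.
(* Dominance of [t] at the summit can only hold in the order [k]: in the others the summit lies
   strictly above a point of [s]. *)
have yE : y = summit above_ex k.
  apply: (@r_inj k); apply/eqP; rewrite eqn_leq summit_ge //=.
  have /dominantP/(_ (summit above_ex k))[l lP] := tD.
  have [kl|lk] := eqVneq l k; first by rewrite -[X in r X]kl lP // setU11.
  have /aboveP/(_ l lk) := summit_above above_ex k.
  by rewrite ltnNge lP // setU1r ?lowest_in.
have [ki|ki] := eqVneq k i; first by left; rewrite -ki.
have [kj|kj] := eqVneq k j; first by right; rewrite -kj.
move/eqP: ij; case; apply: low_inj.
by rewrite !lowE // eq_sym.
Qed.

(** Two indices share a lowest point, because [lowest] maps [I] onto a set with one element less.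
    The points completing [s] are then exactly the two summits, which differ. *)
Lemma facet_even : ~~ odd #|[set y | (y \notin s) && dominant (y |: s)]|.
Proof.
have /injectivePn[i [j ij lowij]] : ~~ injectiveb (lowest s x0).
  apply/negP => /injectiveP low_inj; have := card_imset I low_inj.
  by rewrite (lowest_imset x0s sD) cardI => /n_Sn.
have ji : j != i by rewrite eq_sym.
rewrite (_ : [set y | _] = [set summit above_ex i; summit above_ex j]).
  rewrite cards2; case: eqP => // e.
  have := above_le x0s sD (summit_above above_ex i) (lowest_in x0s i).
  by rewrite e leqNgt; have /aboveP -> := summit_above above_ex j.
apply/setP => y; rewrite !inE; apply/andP/orP => [[ys yD]|].
  by have [->|->] := cofacet_summit ij lowij ys yD; rewrite eqxx; [left|right].
case=> /eqP ->; split.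
- exact: summit_notin ij lowij.
- exact: summit_dominant.
- exact: summit_notin ji (esym lowij).
- exact: summit_dominant.
Qed.

End Cofacets.

(** * Parity count of doors and rooms *)

Section Colouring.
(** [m i] is an added point of colour [i]; the points outside [codom m], of which [x1] is one, are
    the ordinary ones. *)
Variables (c : T -> I) (m : I -> T) (x1 : T).
Hypotheses (c_m : cancel m c) (x1_m : x1 \notin codom m).
Hypothesis m_min : forall i x, r i (m i) <= r i x.
Hypothesis m_big : forall i j x,
  x \notin codom m -> j != i -> r i x < r i (m j).
Variable i0 : I.

(* [s] is a door of the room [y |: s]: its colours are all but [i0]. *)
Definition door s y :=
  [&& y \notin s, dominant (y |: s) & [set c x | x in s] == [set~ i0]].

Lemma card_door s y : door s y -> #|I| = #|s|.+1.
Proof.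
case/and3P=> ys tD /eqP cs; apply/eqP; rewrite eqn_leq; apply/andP; split.
  have I_gt0 : 0 < #|I| by apply/card_gt0P; exists i0.
  by rewrite -(prednK I_gt0) ltnS -(cardsC1 i0) -cs leq_imset_card.
by have := dominant_leq (setU11 y s) tD; rewrite cardsU1 ys.
Qed.

(** Such a door contains an ordinary point [x0]. Each [m k] then lies above the lowest points for
    all orders but [k], so the summits exist and [facet_even] applies. *)
Lemma door_even s : s != [set m i | i in [set~ i0]] ->
  ~~ odd #|[set y | door s y]|.
Proof.
move=> sm; have [->|[y]] := set_0Vmem [set y | door s y].
  by rewrite cards0.
rewrite inE => sy; have cardI := card_door sy.
have /and3P[ys tD /eqP cs] := sy.
have sD : dominant s by apply: dominantS tD; apply: finset.subsetUr.
have [x0 x0s x0m] : exists2 x0, x0 \in s & x0 \notin codom m.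
  apply/exists_inP; apply: contraNT sm => /exists_inPn sm.
  have {}sm x : x \in s -> x = m (c x).
    by move=> /sm; rewrite negbK => /codomP[i ->]; rewrite c_m.
  rewrite -cs; apply/eqP/setP => x.
  apply/idP/imsetP => [xs|[_ /imsetP[z zs ->] ->]].
    by exists (c x); [apply: imset_f|apply: sm].
  by rewrite -sm.
rewrite (_ : [set y | _] = [set y | (y \notin s) && dominant (y |: s)]); last first.
  by apply/setP => z; rewrite !inE /door cs eqxx andbT.
apply: (facet_even x0s sD cardI) => k; exists (m k); apply/aboveP => l lk.
by apply: leq_ltn_trans (lowest_le x0s l x0s) (m_big x0m _); rewrite eq_sym.
Qed.

(** The only completion is the ordinary point highest in the order [i0]. *)
Lemma door_odd : #|[set y | door [set m i | i in [set~ i0]] y]| = 1%N.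
Proof.
set s := imset _ _.
pose y0 := [arg max_(y > x1 | y \notin codom m) r i0 y].
have [y0m y0max] : y0 \notin codom m /\
    forall y, y \notin codom m -> r i0 y <= r i0 y0.
  by rewrite /y0; case: arg_maxnP => // y ym ymax; split=> // z /ymax.
have cs : [set c x | x in s] = [set~ i0].
  rewrite -imset_comp; under eq_imset do rewrite /= c_m.
  by rewrite imset_id.
have sm x : x \in s -> x \in codom m by case/imsetP => i _ ->; apply: codom_f.
apply/eqP/cards1P; exists y0; apply/setP => y; rewrite !inE /door cs eqxx andbT.
apply/andP/eqP => [[ys yD]|->]; last first.
  split; first by apply: contra y0m; apply: sm.
  apply/dominantP => z; have [/codomP[i ->]|zm] := boolP (z \in codom m).
    by exists i => x _; apply: m_min.
  exists i0 => x /setU1P[->|/imsetP[i]]; first exact: y0max.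
  by rewrite !inE => ii0 ->; apply/ltnW/m_big.
have im i : i != i0 -> m i \in s by move=> ii0; apply: imset_f; rewrite !inE.
(* For [i != i0] the set contains [m i], the minimum of the order [i], so an ordinary point cannot
   be dominated there. *)
have far z i : z \notin codom m ->
    {in y |: s, forall x, r i z <= r i x} -> i = i0.
  move=> zm iz; apply/eqP/negPn/negP => ii0; case/negP: zm.
  rewrite (_ : z = m i) ?codom_f //; apply: (@r_inj i); apply/eqP.
  by rewrite eqn_leq m_min iz // setU1r ?im.
(* Otherwise [y = m i0], and dominance would rank [x1] no higher than this minimum of the order
   [i0]. *)
have ym : y \notin codom m.
  apply/negP => /codomP[i yi].
  have ii0 : i = i0 by apply/eqP/negPn/negP => /im; rewrite -yi (negPf ys).
  have /dominantP/(_ x1)[j jP] := yD; have ji0 := far _ _ x1_m jP.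
  have := jP y (setU11 _ _); rewrite yi ii0 ji0 => x1le; case/negP: x1_m.
  rewrite (_ : x1 = m i0) ?codom_f //; apply: (@r_inj i0); apply/eqP.
  by rewrite eqn_leq m_min x1le.
apply: (@r_inj i0); apply/eqP; rewrite eqn_leq y0max //=.
have /dominantP/(_ y0)[i iP] := yD.
by have <- := far _ _ y0m iP; apply: iP; apply: setU11.
Qed.

(* The same relation seen from the room [t]: its facet [t :\ y] is a door. *)
Definition door_opposite t y :=
  [&& y \in t, dominant t & [set c x | x in t :\ y] == [set~ i0]].

(** A room with a door but not all colours lacks exactly [i0]. Having at most [#|I|] points, it
    repeats a single colour, at [y] and [z]; removing either of these, and no other point, leaves a
    door. *)
Lemma door_opposite_even t : [set c x | x in t] != [set: I] ->
  ~~ odd #|[set y | door_opposite t y]|.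
Proof.
move=> ct; have [->|[y]] := set_0Vmem [set y | door_opposite t y].
  by rewrite cards0.
rewrite inE => /and3P[yt tD /eqP cy].
have c_neq x : x \in t -> c x != i0.
  move=> xt; apply: contraNneq ct => cx; rewrite -finset.subTset.
  apply/fintype.subsetP => i _.
  have [->|ii0] := eqVneq i i0; first by rewrite -cx imset_f.
  have : i \in [set c x | x in t :\ y] by rewrite cy !inE.
  by case/imsetP => z; rewrite !inE => /andP[_ zt] ->; rewrite imset_f.
have : c y \in [set c x | x in t :\ y] by rewrite cy !inE c_neq.
case/imsetP => z; rewrite !inE => /andP[zy zt] cyz.
have I_gt0 : 0 < #|I| by apply/card_gt0P; exists i0.
have t_le : #|t :\ y| <= #|I|.-1.
  by rewrite -ltnS prednK //; have := dominant_leq yt tD; rewrite (cardsD1 y) yt.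
have c_inj : {in t :\ y &, injective c}.
  by apply/imset_injP; rewrite eqn_leq leq_imset_card cy cardsC1 t_le.
have yz : y != z by rewrite eq_sym.
rewrite (_ : [set y | _] = [set y; z]); first by rewrite cards2 yz.
apply/setP => x; rewrite !inE /door_opposite tD /=.
apply/andP/orP => [[xt /eqP cx]|].
  have : c x \in [set c x | x in t :\ x] by rewrite cx !inE c_neq.
  case/imsetP => w; rewrite !inE => /andP[wx wt] cxw.
  have [->|xy] := eqVneq x y; [by left|right].
  have [wy|wy] := eqVneq w y.
    by apply/eqP/c_inj; rewrite ?inE ?xy ?zy // cxw wy.
  by case/eqP: wx; apply: c_inj; rewrite ?inE ?xy ?wy.
case=> /eqP ->; first by rewrite yt cy.
split=> //; rewrite -cy; apply/eqP/setP => i; apply/imsetP/imsetP => -[w].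
  rewrite !inE => /andP[wz wt] ->; have [->|wy] := eqVneq w y.
    by exists z; rewrite // !inE zy.
  by exists w; rewrite // !inE wy.
rewrite !inE => /andP[wy wt] ->; have [->|wz] := eqVneq w z.
  by exists y; rewrite // !inE yz.
by exists w; rewrite // !inE wz.
Qed.

(** Toggling the membership of [y] exchanges a door [s] with the room [y |: s]. *)
Lemma sum_door_opposite :
  (\sum_s #|[set y | door s y]| = \sum_t #|[set y | door_opposite t y]|)%N.
Proof.
have cardE (P : {set T} -> pred T) :
    (\sum_s #|[set y | P s y]| = \sum_y \sum_s (P s y : nat))%N.
  rewrite exchange_big; apply: eq_bigr => s _.
  by rewrite -sum1dep_card big_mkcond.
rewrite !cardE; apply: eq_bigr => y _.
pose toggle s := if y \in s then s :\ y else y |: s.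
have toggleK : involutive toggle.
  move=> s; rewrite /toggle; have [ys|ys] := boolP (y \in s).
    by rewrite !inE eqxx /= finset.setD1K.
  by rewrite setU11 finset.setU1K.
rewrite [RHS](reindex_inj (inv_inj toggleK)); apply: eq_bigr => s _.
rewrite /door /door_opposite /toggle; have [ys|ys] := boolP (y \in s).
  by rewrite !inE eqxx.
by rewrite setU11 finset.setU1K.
Qed.

(* Only the facet of added points [m i], [i != i0], lies in a single room, so if
   no room had all colours, the number of pairs (door, room) would be both odd
   and even. *)
Lemma scarf : exists2 s, dominant s & [set c x | x in s] = [set: I].
Proof.
suff /exists_inP[s sD /eqP] :
    [exists (s | dominant s), [set c x | x in s] == [set: I]].
  by exists s.
apply: contraT => /exists_inPn no_room; exfalso.
suff : odd (\sum_s #|[set y | door s y]|).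
  rewrite sum_door_opposite; apply/negP.
  apply: (big_ind (fun n => ~~ odd n)) => // [p q|t _].
    by rewrite oddD => /negPf -> /negPf ->.
  have [tD|tD] := boolP (dominant t); first exact/door_opposite_even/no_room.
  rewrite (_ : [set y | _] = finset.set0) ?cards0 //.
  by apply/setP => y; rewrite !inE /door_opposite (negPf tD) andbF.
rewrite (bigD1 [set m i | i in [set~ i0]]) //= door_odd /=.
apply: (big_ind (fun n => ~~ odd n)) => // [p q|s sm].
  by rewrite oddD => /negPf -> /negPf ->.
exact: door_even.
Qed.

End Colouring.
End DominantSets.

(** * Colourings of the integer points of a dilated simplex *)

Section Grid.
Import fintype finset.
Variables (n N : nat).

(** The bound on the coordinates, implied by their sum, makes the type finite. *)
Definition grid := {x : {ffun 'I_n -> 'I_N.+1} | \sum_i (x i : nat) == N}.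

Definition coord (x : grid) (i : 'I_n) : nat := val x i.

Lemma sum_coord x : \sum_i coord x i = N.
Proof. exact/eqP/(valP x). Qed.

Lemma gridP (f : 'I_n -> nat) : \sum_i f i = N -> exists x, coord x =1 f.
Proof.
move=> fN; have f_le i : f i < N.+1 by rewrite ltnS -fN (bigD1 i) //= leq_addr.
pose x : {ffun 'I_n -> 'I_N.+1} := [ffun i => inord (f i)].
have xP : \sum_i (x i : nat) == N.
  by apply/eqP; rewrite -[RHS]fN; apply: eq_bigr => i _; rewrite ffunE inordK.
by exists (exist _ x xP) => i; rewrite /coord /= ffunE inordK.
Qed.

Lemma sum_add_delta (f : 'I_n -> nat) (i0 : 'I_n) d :
  \sum_i (f i + (i == i0) * d) = \sum_i f i + d.
Proof.
rewrite big_split /=; congr (_ + _).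
rewrite (bigD1 i0) //= eqxx mul1n big1 ?addn0 // => i.
by move=> /negPf ->.
Qed.

(* The added point [inl i] is the minimum for the i-th order and lies above the
   whole grid for all the others; it stands for the facet x_i = 0. *)
Definition grid_rank (i : 'I_n) (t : 'I_n + grid) : nat :=
  match t with
  | inl j => if j == i then 0 else #|{: grid}| * N.+1 + j.+1
  | inr x => (coord x i * #|{: grid}| + enum_rank x).+1
  end.

Lemma grid_rank_lt i x j : j != i -> grid_rank i (inr x) < grid_rank i (inl j).
Proof.
move=> /negPf /= ->; rewrite addnS ltnS.
apply: leq_trans (leq_addr _ _); rewrite mulnC.
have x_lt : coord x i < N.+1 by apply: ltn_ord.
apply: leq_trans (leq_mul (leqnn _) x_lt).
by rewrite mulnS addnC ltn_add2r; apply: ltn_ord.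
Qed.

(** The rank is lexicographic: [enum_rank] stays below [#|{: grid}|], so it only breaks ties between
    coordinates. *)
Lemma coord_le i x y :
  grid_rank i (inr x) <= grid_rank i (inr y) -> coord x i <= coord y i.
Proof.
rewrite /= ltnS !(mulnC _ #|_|); apply: contraTT; rewrite -!ltnNge => yx.
have y_lt : enum_rank y < #|{: grid}| by apply: ltn_ord.
apply: leq_trans (leq_addr _ _); apply: leq_trans (leq_mul (leqnn _) yx).
by rewrite mulnS addnC ltn_add2r.
Qed.

Lemma grid_rank_inj i : injective (grid_rank i).
Proof.
move=> [j|x] [k|y].
- rewrite /=; case: eqP => [->|_]; case: eqP => [->|_] //; try lia.
  by move=> e; congr inl; apply: val_inj => /=; lia.
- have [->|ji e] := eqVneq j i; first by rewrite /= eqxx.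
  by have := grid_rank_lt y ji; rewrite e ltnn.
- have [->|ki e] := eqVneq k i; first by rewrite /= eqxx.
  by have := grid_rank_lt x ki; rewrite e ltnn.
move=> e; congr inr; apply: enum_rank_inj; apply: ord_inj.
have : coord x i = coord y i.
  by apply/eqP; rewrite eqn_leq; apply/andP; split; apply: coord_le; rewrite e.
by move: e => /= [+ xy]; rewrite xy => /addnI.
Qed.

(** Scarf's theorem gives a dominant set [s] of all colours. Its grid points exceed the vector [b]
    of their lowest coordinates (set to 0 outside [C]) by less than [n] in total, and [z] is [b]
    raised to the sum [N]. *)
Lemma grid_colouring (c : grid -> 'I_n) : 0 < n ->
  exists z, forall i, 0 < coord z i ->
    exists2 p, c p = i & forall k, coord z k <= coord p k + n
                               /\ coord p k <= coord z k + n.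
Proof.
move=> n_gt0; pose i0 := Ordinal n_gt0.
have [x1 _] : exists x, coord x =1 (fun i => 0 + (i == i0) * N).
  by apply: gridP; rewrite sum_add_delta big1.
pose c' t := match t with inr x => c x | inl j => j end.
have codom_inl t : t \notin codom (@inl 'I_n grid) -> exists x, t = inr x.
  by case: t => [j|x]; [rewrite codom_f|exists x].
have [||i t|i j t|s /dominantP sD cs] :=
    @scarf _ _ _ grid_rank_inj c' inl (inr x1) _ _ _ _ i0.
- by move=> j.
- by apply/codomP => -[].
- by rewrite /= eqxx.
- by move=> /codom_inl[x ->]; apply: grid_rank_lt.
pose C := [set i | inl i \notin s]; pose P x := inr x \in s.
(* The index lies in [C], since [inl i] has rank 0 in the order [i] and so cannot lie above a grid
   point. *)
have dom y : exists2 i, i \in C & forall x, P x -> coord y i <= coord x i.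
  have [i iP] := sD (inr y); exists i; last by move=> x /iP/coord_le.
  by rewrite inE; apply/negP => /iP; rewrite /= eqxx.
have colour i : i \in C -> exists2 x, P x & c x = i.
  rewrite inE => iC; have : i \in [set c' t | t in s] by rewrite cs inE.
  case/imsetP => -[j|x] ts ic; last by exists x.
  by rewrite ic ts in iC.
have [i1 i1C _] := dom x1; have [x0 x0P _] := colour _ i1C.
pose low i := coord [arg min_(x < x0 | P x) coord x i] i.
have low_le i x : P x -> low i <= coord x i.
  by rewrite /low; case: arg_minnP => // y _; apply.
have low_ex i : exists2 x, P x & low i = coord x i.
  by rewrite /low; case: arg_minnP => // y yP _; exists y.
pose b i := if i \in C then low i else 0.
have b_le i x : P x -> b i <= coord x i.
  by move=> xP; rewrite /b; case: ifP => // _; apply: low_le.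
have sum_b : \sum_i b i <= N.
  by rewrite -(sum_coord x0) leq_sum // => i _; apply: b_le.
(* Otherwise there is room for a grid point [y] strictly above [low] at every index of [C], which
   contradicts dominance. *)
have N_lt : N < \sum_i b i + n.
  rewrite ltnNge; apply/negP => b_small.
  have N_ge : \sum_i (if i \in C then (low i).+1 else 0) <= N.
    apply: leq_trans b_small; rewrite -[X in _ + X]card_ord -sum1_card -big_split.
    by apply: leq_sum => i _; rewrite /b; case: ifP => //=; rewrite addn1.
  have [y yE] := gridP (etrans (sum_add_delta _ i1 _) (subnKC N_ge)).
  have [i iC iy] := dom y; have [x xP lowx] := low_ex i.
  by have := iy _ xP; rewrite yE iC -lowx leqNgt addSn ltnS leq_addr.
(* The missing amount is put on [i1], which lies in [C], so the support of [z] stays in [C]. *)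
have [z zE] := gridP (etrans (sum_add_delta _ i1 _) (subnKC sum_b)).
exists z => i; rewrite zE => zi_gt0.
have iC : i \in C.
  move: zi_gt0; rewrite /b; case: ifP => // iC.
  have [ii1|//] := eqVneq i i1.
  by rewrite ii1 i1C in iC.
have [p pP cp] := colour _ iC; exists p => // k.
have pk := b_le k _ pP; rewrite zE; split; first by case: (k == i1); lia.
(* As the coordinates of [p] sum to [N] and the others are at least those of [b], the [k]-th one is
   less than [b k + n]. *)
have : \sum_(j | j != k) b j <= \sum_(j | j != k) coord p j.
  by apply: leq_sum => j _; apply: b_le.
have := sum_coord p; rewrite (bigD1 k) //=.
by move: N_lt sum_b; rewrite (bigD1 k) //=; lia.
Qed.
End Grid.

Local Open Scope classical_set_scope.
Local Open Scope ring_scope.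

(** * Open covers of the standard simplex *)

Section OpenCover.
Context {R : realType} {n : nat}.

Definition simplex : set 'rV[R]_n :=
  [set x | (forall i, 0 <= x 0 i) /\ \sum_i x 0 i = 1].

Lemma simplex_compact : compact simplex.
Proof.
have -> : simplex = [set x : 'rV[R]_n | forall i, x 0 i \in `[0, 1]] `&`
                    (fun x : 'rV[R]_n => \sum_i x 0 i) @^-1` [set 1].
  apply/seteqP; split=> x [].
    move=> x_ge0 x1; split=> //= i; rewrite in_itv /= x_ge0 /= -x1 (bigD1 i) //=.
    by rewrite lerDl sumr_ge0.
  by move=> x_ge0 x1; split=> // i; have /itvP -> := x_ge0 i.
apply: compact_closedI.
  by apply: (@rV_compact R n (fun=> `[0, 1]%classic)) => _; apply: segment_compact.
apply: closed_comp => [x _|]; last exact: closed_eq.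
by apply: (continuous_big add_continuous) => i _; apply: coord_continuous.
Qed.

Lemma simplex_lebesgue_number (U : 'I_n -> set 'rV[R]_n) :
  (forall x, simplex x -> exists i, \forall y \near x, simplex y -> U i y) ->
  exists e : nat, forall x, simplex x -> exists i, forall y, simplex y ->
    ball x e.+1%:R^-1 y -> U i y.
Proof.
move=> Ucover.
have /compact_near_coveringP/(_ nat \oo (fun e x => exists i, forall y,
  simplex y -> ball x e.+1%:R^-1 y -> U i y)) := simplex_compact.
case=> [x /Ucover[i /nbhs_ballP[d /= d_gt0 dU]]|e _ eP]; last first.
  by exists e; apply: eP => /=.
have d2_gt0 : 0 < d / 2 by rewrite divr_gt0.
exists (ball x (d / 2), [set e | e.+1%:R^-1 < d / 2]).
  split=> /=; first exact: nbhsx_ballx.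
  exact: near_infty_natSinv_lt (PosNum d2_gt0).
move=> [y e] /= [xy eN]; exists i => z zS yz; apply: dU zS.
rewrite [d]splitr; apply: ball_triangle xy _.
by apply: le_ball yz; apply: ltW.
Qed.

(** A covering lemma of KKM type: a grid point gets as colour an index [i] such that [U i] contains
    its Lebesgue ball within the simplex. *)
Lemma open_cover_simplex (U : 'I_n -> set 'rV[R]_n) : (0 < n)%N ->
  (forall x, simplex x -> exists i, \forall y \near x, simplex y -> U i y) ->
  exists2 x, simplex x & forall i, 0 < x 0 i -> U i x.
Proof.
move=> n_gt0 /simplex_lebesgue_number[e eP].
(* Coordinates of grid points that differ by at most [n] differ by at most [n / N < 1 / e.+1] after
   scaling. *)
pose N := (n.+1 * e.+1)%N.
have N_gt0 : 0 < N%:R :> R by rewrite ltr0n.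
pose pt (p : grid n N) : 'rV[R]_n := \row_i ((coord p i)%:R / N%:R).
have ptS p : simplex (pt p).
  split=> [i|]; first by rewrite mxE divr_ge0.
  under eq_bigr do rewrite mxE.
  by rewrite -mulr_suml -natr_sum sum_coord divff // gt_eqF.
have [c cP] := choice (fun p => eP _ (ptS p)).
have [z zP] := grid_colouring c n_gt0.
exists (pt z) => // i; rewrite mxE pmulr_lgt0 ?invr_gt0 // ltr0n => /zP[p <- pz].
apply: cP => //; split=> [|? k]; first by rewrite invr_gt0.
rewrite !ord1 !mxE -ball_normE /ball_ /= -mulrBl normrM normfV [X in _ / X]gtr0_norm //.
rewrite ltr_pdivrMr // /N natrM mulrCA mulVf ?mulr1 ?pnatr_eq0 //.
have [zp pz_le] := pz k.
apply: (@le_lt_trans _ _ n%:R); last by rewrite ltr_nat.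
by rewrite ler_norml lerBrDl !lerBlDr -!natrD !ler_nat zp addnC.
Qed.

End OpenCover.

Lemma compact_finite_subcover (T : topologicalType) (A : eqType) (C : set A)
    (U : A -> set T) : compact [set: T] ->
  (forall x : T, exists2 a, C a & nbhs x (U a)) ->
  exists2 s : seq A, {in s, forall a, C a} &
    forall x, exists2 a, a \in s & U a x.
Proof.
move=> /compact_near_coveringP cT CU.
(* The filter of finite families directed by inclusion: compactness yields one [s] in [C] such that
   every larger family covers, in particular [s]. *)
pose F := filter_from [set s : seq A | {in s, forall a, C a}]
                      (fun s => [set t : seq A | {subset s <= t}]).
have FF : Filter F.
  apply: filter_from_filter; first by exists [::].
  move=> s t sC tC; exists (s ++ t) => [a|u stu].
    by rewrite mem_cat => /orP[/sC|/tC].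
  by split=> a au; apply: stu; rewrite mem_cat au ?orbT.
have [x _|s sC sU] := cT _ F (fun s x => exists2 a, a \in s & U a x) FF.
  have [a Ca xU] := CU x; exists (U a, [set s | a \in s]).
    split=> //=; exists [:: a] => [b|s]; first by rewrite inE => /eqP ->.
    by apply; rewrite inE.
  by move=> [y s] /= [yU sa]; exists a.
by exists s => // x; apply: sU.
Qed.

Section Convexity.
Context {R : realType} {X : lmodType R}.

Lemma convex_set_sum (K : set X) n (l : 'I_n -> R) (v : 'I_n -> X) :
  convex_set K -> (forall i, K (v i)) -> (forall i, 0 <= l i) ->
  \sum_i l i = 1 -> K (\sum_i l i *: v i).
Proof.
move=> K_convex; elim: n l v => [|n IH] l v vK l_ge0.
  by rewrite big_ord0 => /eqP; rewrite eq_sym oner_eq0.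
rewrite !big_ord_recl => l1; set s := \sum_(i < n) _ in l1.
have s_ge0 : 0 <= s by apply: sumr_ge0.
(* If [s] is 0 the remaining coefficients all vanish; otherwise they are divided by [s] to apply the
   induction hypothesis. *)
have [s0|s_neq0] := eqVneq s 0.
  rewrite big1 => [|i _]; first
    by move: l1; rewrite s0 !addr0 => ->; rewrite scale1r.
  have /eqP := s0; rewrite psumr_eq0 // => /allP/(_ i).
  by rewrite mem_index_enum => /(_ isT)/eqP ->; rewrite scale0r.
have l0_le1 : l ord0 <= 1 by rewrite -l1 lerDl.
have := K_convex (v ord0) (\sum_(i < n) (l (lift ord0 i) / s) *: v (lift ord0 i))
  (Itv01 (l_ge0 ord0) l0_le1).
rewrite !inE => /(_ (vK _)).
rewrite /conv /= (_ : l ord0 = 1 - s); last by rewrite -l1 addrK.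
rewrite /unstable.onem subKr scaler_sumr => sumK.
have -> : \sum_(i < n) l (lift ord0 i) *: v (lift ord0 i) =
    \sum_(i < n) s *: ((l (lift ord0 i) / s) *: v (lift ord0 i)).
  by apply: eq_bigr => i _; rewrite scalerA mulrCA divff // mulr1.
apply: sumK; apply: IH => [i|i|]; first exact: vK.
  by rewrite divr_ge0.
by rewrite -mulr_suml divff.
Qed.

End Convexity.

(** * Variational inequalities *)

Lemma linear_combination_continuous (R : realType) (V : lmodType R)
    (tau : Topological V) n (v : 'I_n -> V) : linear_topology tau ->
  continuous ((fun l => \sum_i l 0 i *: v i) : 'rV[R]_n -> Topological.Pack tau).
Proof.
move=> [add_cont scale_cont].
apply: (@continuous_big (Topological.Pack tau) _ (@GRing.add V) 0 _ add_cont) => i _ l.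
pose T := Topological.Pack tau.
apply: (@continuous2_cvg _ R^o T T (nbhs l) _ (fun l => l 0 i) (fun=> v i) *:%R).
- exact: (scale_cont (l 0 i, v i)).
- exact: coord_continuous.
- exact: cvg_cst.
Qed.

Section Variational.
Context {R : realType} {X Y : lmodType R}.
Variables (br : {bilinear X -> Y -> R | *%R & *%R}) (K : set X) (F : K -> Y).
Variable beta : Topological (lin K).
Hypotheses (K_convex : convex_set K) (beta_linear : linear_topology beta).

(** The function f_a of the statement; it is affine in [a] and vanishes at [a = val x]. *)
Definition gap (a : X) (x : trace beta) : R := br (a - val (x : K)) (F x).

Lemma finite_variational_inequality n (a : 'I_n -> X) :
  (0 < n)%N -> (forall i, K (a i)) ->
  (forall i, upper_semicontinuous (gap (a i))) ->
  exists x, forall i, 0 <= gap (a i) x.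
Proof.
move=> n_gt0 aK gap_usc; apply: contrapT => no_sol.
have neg x : exists i, gap (a i) x < 0.
  apply: contrapT => x_sol; apply: no_sol; exists x => i.
  by rewrite leNgt; apply/negP => xi; apply: x_sol; exists i.
pose b i := to_lin (exist _ (a i) (mem_set (aK i)) : K).
pose psi (l : 'rV[R]_n) := \sum_i l 0 i *: b i.
(* [psi l] lives in [lin K] and may leave [K] when [l] is outside the simplex, hence the quantified
   [x]. *)
pose U i := [set l | exists2 x : K, to_lin x = psi l & gap (a i) x < 0].
have simplex_psi l : simplex l ->
    exists2 x : K, to_lin x = psi l & val x = \sum_i l 0 i *: a i.
  move=> [l_ge0 l1]; have lK := convex_set_sum K_convex aK l_ge0 l1.
  exists (exist (fun x => x \in K) _ (mem_set lK)) => //; apply: val_inj; rewrite /psi.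
  by rewrite [RHS]raddf_sum; apply: eq_bigr => i _; rewrite [RHS]linearZ.
have [l /simplex_psi lS|z zS zU] := open_cover_simplex (U := U) n_gt0.
  have [x xl _] := lS; have [i xi] := neg x; exists i.
  (* Neighbourhoods in the trace come from open sets [B] of [lin K], which can be pulled back along
     the continuous [psi]. *)
  have [_ [[B Bo <-] Bx] B_neg] := gap_usc i _ _ xi.
  have psi_cont := linear_combination_continuous (v := b) beta_linear.
  have : \forall l' \near l, B (psi l').
    apply: psi_cont; apply: open_nbhs_nbhs; split=> //.
    by move: Bx; rewrite /= xl.
  apply: filterS => l' Bl' /simplex_psi[y yl _]; exists y => //.
  by apply: B_neg; rewrite /= yl.
have [x xz xE] := simplex_psi _ zS.
have {zU} x_neg i : 0 < z 0 i -> gap (a i) x < 0.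
  move=> /zU[y yz]; suff -> : y = x by [].
  by apply: val_inj; have := congr1 val (etrans yz (esym xz)).
have [z_ge0 z1] := zS.
have sum0 : \sum_i z 0 i * gap (a i) x = 0.
  under eq_bigr do rewrite /gap -linearZl_LR scalerBr.
  by rewrite -linear_sumlz sumrB -scaler_suml z1 scale1r -xE subrr linear0l.
(* A positive weight would contribute a negative term to [sum0], and no term is positive; so all
   weights vanish, although they sum to 1. *)
have : \sum_i z 0 i = 0.
  apply: big1 => i _; apply/eqP; rewrite eq_le z_ge0 andbT leNgt; apply/negP => zi.
  move: sum0; rewrite (bigD1 i) //=; apply/eqP; rewrite lt_eqF //.
  rewrite ltr_wnDr ?pmulr_rlt0 ?x_neg // sumr_le0 // => j _.
  have := z_ge0 j; rewrite le_eqVlt => /predU1P[<-|zj]; first by rewrite mul0r.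
  by rewrite pmulr_rle0 // ltW ?x_neg.
by rewrite z1 => /eqP; rewrite oner_eq0.
Qed.

Lemma variational_inequality (C : set X) : C !=set0 -> C `<=` K ->
  compact [set: trace beta] ->
  (forall a, C a -> upper_semicontinuous (gap a)) ->
  exists x : K, forall u, conv_hull C u -> 0 <= br (u - val x) (F x).
Proof.
move=> [a0 a0C] CK cK gap_usc.
suff [x xC] : exists x, forall a, C a -> 0 <= gap a x.
  exists x => _ [n [l [v [vC l_ge0 l1 ->]]]].
  rewrite -[val x]scale1r -l1 scaler_suml -sumrB linear_sumlz sumr_ge0 // => i _.
  by rewrite -scalerBr linearZl_LR mulr_ge0 ?xC.
apply: contrapT => no_sol.
have [x|s sC s_neg] := compact_finite_subcover
    (C := C) (U := fun a => [set x | gap a x < 0]) cK.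
  apply: contrapT => x_sol; apply: no_sol; exists x => a aC.
  rewrite leNgt; apply/negP => xa; apply: x_sol.
  by exists a => //; apply: gap_usc.
(* [K] has a point, so [s] is nonempty, as the finite case requires; [a] also serves as default for
   [nth]. *)
have [a a_s _] := s_neg (exist (fun x => x \in K) a0 (mem_set (CK _ a0C)) : K).
have nth_C (i : 'I_(size s)) : C (nth a s i) by apply/sC/mem_nth.
have [|i|i|x xs] := @finite_variational_inequality (size s) (fun i => nth a s i).
- by case: s a_s {s_neg sC nth_C}.
- exact/CK/nth_C.
- exact/gap_usc/nth_C.
have [b b_s] := s_neg x; rewrite /= ltNge; apply/negP/negPn.
have := xs (Ordinal (_ : (index b s < size s)%N)); rewrite /= index_mem nth_index //.
exact.
Qed.

End Variational.

(** * Nets *)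

Section NetsAndSemicontinuity.
Context {R : realType} {T : topologicalType}.

(** The neighbourhoods of [x0], ordered by reverse inclusion, index the net; each contributes one of
    its points outside [P]. *)
Lemma net_of_not_near (x0 : T) (P : set T) : ~ (\forall y \near x0, P y) ->
  exists (I : Type) (le : I -> I -> Prop) (x : I -> T),
    [/\ directed le, x @ net_tails le --> x0 & forall i, ~ P (x i)].
Proof.
move=> notP; pose I := {U : set T | nbhs x0 U}.
have /choice[x xP] (U : I) : exists y, sval U y /\ ~ P y.
  case: U => U xU; apply: contrapT => UP; apply: notP.
  apply: (filterS _ xU) => y Uy.
  by apply: contrapT => Py; apply: UP; exists y.
exists I, (fun U V => sval V `<=` sval U), x; split=> [|A xA|U].
- split=> [|U|U V W UV VW|[U xU] [V xV]].
  + exact: (inhabits (exist _ setT (@filterT _ (nbhs x0) _))).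
  + exact: subset_refl.
  + exact: subset_trans VW UV.
  + by exists (exist _ (U `&` V) (filterI xU xV)); split=> y [].
- exists (exist _ A xA) => // V VA; apply: VA; exact: (xP V).1.
- exact: (xP U).2.
Qed.

Lemma net_limsup_le (g : T -> R) (I : Type) (le : I -> I -> Prop)
    (x : I -> T) (x0 : T) : upper_semicontinuous g ->
  x @ net_tails le --> x0 -> (net_limsup le (g \o x) <= (g x0)%:E)%E.
Proof.
move=> g_usc x_cvg; apply/lee_addgt0Pr => e e_gt0; rewrite -EFinD.
have /x_cvg[i _ iP] : nbhs x0 [set y | g y < g x0 + e].
  by apply: g_usc; rewrite ltrDl.
apply: (@le_trans _ _ (ereal_sup [set (g (x j))%:E | j in [set j | le i j]])).
  by apply: ereal_inf_lbound; exists i.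
by apply: ge_ereal_sup => _ [j ij <-]; rewrite lee_fin; apply/ltW/iP.
Qed.

(** If semicontinuity failed at [x0] and [a], a net converging to [x0] with values at least [a]
    would have limsup at least [a], above [g x0]. *)
Lemma usc_of_nets (g : T -> R) :
  (forall (I : Type) (le : I -> I -> Prop) (x : I -> T) (x0 : T),
     directed le -> x @ net_tails le --> x0 ->
     (net_limsup le (g \o x) <= (g x0)%:E)%E) ->
  upper_semicontinuous g.
Proof.
move=> g_net x0 a ga; apply: contrapT => /net_of_not_near.
move=> [I [le [x [le_dir x_cvg x_far]]]].
have := g_net _ _ _ _ le_dir x_cvg; apply/negP; rewrite -ltNge.
apply: (@lt_le_trans _ _ a%:E); first by rewrite lte_fin.
apply: le_ereal_inf_tmp => _ [i _ <-]; have [_ le_refl _ _] := le_dir.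
apply: (@le_trans _ _ (g (x i))%:E); last by apply: ereal_sup_ubound; exists i.
by rewrite lee_fin leNgt; apply/negP/x_far.
Qed.

Lemma lsc_of_nets (g : T -> R) :
  (forall (I : Type) (le : I -> I -> Prop) (x : I -> T) (x0 : T),
     directed le -> x @ net_tails le --> x0 ->
     ((g x0)%:E <= net_liminf le (g \o x))%E) ->
  forall x0 a, a < g x0 -> \forall y \near x0, a < g y.
Proof.
move=> g_net x0 a ga; apply: contrapT => /net_of_not_near.
move=> [I [le [x [le_dir x_cvg x_far]]]].
have := g_net _ _ _ _ le_dir x_cvg; apply/negP; rewrite -ltNge.
apply: (@le_lt_trans _ _ a%:E); last by rewrite lte_fin.
apply: ge_ereal_sup => _ [i _ <-]; have [_ le_refl _ _] := le_dir.
apply: (@le_trans _ _ (g (x i))%:E); first by apply: ereal_inf_lbound; exists i.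
by rewrite lee_fin leNgt; apply/negP/x_far.
Qed.

End NetsAndSemicontinuity.

Lemma sigma_continuous (R : realType) (X Y : lmodType R) (br : X -> Y -> R) (C : set X)
    (T : topologicalType) (F : T -> sigma_topology br C) (a : X) :
  C a -> continuous F -> continuous ((fun x => br a (F x)) : T -> R^o).
Proof.
move=> aC F_cont x; pose c : C := exist (fun y => y \in C) a (mem_set aC).
have /cvg_sup/(_ c) F_cvg := F_cont x.
exact: (cvg_comp _ _ F_cvg (@initial_continuous _ R^o (br a) (F x))).
Qed.

Theorem theorem29 (R : realType) (X Y : lmodType R)
    (br : {bilinear X -> Y -> R | *%R & *%R})
    (K C : set X) (F : K -> Y) (beta : Topological (lin K))
    (K_convex : convex_set K) (C_neq0 : C !=set0) (C_sub_K : C `<=` K)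
    (beta_linear : linear_topology beta)
    (beta_hausdorff : hausdorff_space (Topological.Pack beta))
    (K_compact : compact [set: trace beta]) :
  let f (a : X) : trace beta -> R := fun x : K => br (a - val x) (F x) in
  let usc := forall a, C a -> upper_semicontinuous (f a) in
  let solvable :=
    exists x : K, forall u, conv_hull C u -> 0 <= br (u - val x) (F x) in
  [/\ usc <->
        (forall (I : Type) (le : I -> I -> Prop)
           (x : I -> trace beta) (x0 : trace beta),
           directed le -> x @ net_tails le --> x0 ->
           forall a, C a ->
             (net_limsup le (fun i => f a (x i)) <= (f a x0)%:E)%E),
      usc -> solvable
    & continuous (F : trace beta -> sigma_topology br C) ->
      (forall (I : Type) (le : I -> I -> Prop)
         (x : I -> trace beta) (x0 : trace beta),
         directed le -> x @ net_tails le --> x0 ->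
         ((br (val (x0 : K)) (F x0))%:E
            <= net_liminf le (fun i => br (val (x i : K)) (F (x i))))%E) ->
      usc /\ solvable].
Proof.
move=> f usc solvable.
have usc_solvable : usc -> solvable by apply: variational_inequality.
split=> // [|F_cont F_lsc].
  split=> [f_usc I le x x0 _ x_cvg a aC|f_net a aC].
    exact: (net_limsup_le (f_usc a aC) x_cvg).
  by apply: usc_of_nets => I le x x0 le_dir x_cvg; apply: f_net.
suff f_usc : usc by split; last exact: usc_solvable.
move=> a aC x0 b; rewrite /f linearBl => x0b.
(* Half the margin: the continuous term and the lower semicontinuous diagonal term may each lose
   [d]. *)
pose d := (b - (br a (F x0) - br (val (x0 : K)) (F x0))) / 2.
have d_gt0 : 0 < d by rewrite divr_gt0 // subr_gt0.
have diag_lsc := @lsc_of_nets _ (trace beta)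
  (fun x => br (val (x : K)) (F x)) F_lsc x0 (br (val (x0 : K)) (F x0) - d).
have := sigma_continuous aC F_cont (x := x0) => /cvgr_lt/(_ (br a (F x0) + d)).
rewrite ltrDl d_gt0 => /(_ isT); apply: filter_app.
have : \forall x \near x0, br (val (x0 : K)) (F x0) - d < br (val (x : K)) (F x).
  by apply: diag_lsc; rewrite ltrBlDr ltrDl.
apply: filterS => x lo hi; rewrite linearBl; move: lo hi; rewrite /d; lra.
Qed.
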